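(* Let $n\ge 2$, $Q=n+2$ (so $Q\geq 4$) and $0<R\leq\infty$. If $(V,W)$ is a $Q$-dimensional Bessel pair on $(0,R)$ with positive solution $f$, then for every $u\in C_c^\infty(B_R(o)\setminus\{o\})$ $$\int_{B_R(o)} V(\varrho)|\nabla_G u|^2\,dx\,dt-\int_{B_R(o)}W(\varrho)u^2|\nabla_G \varrho|^2\,dx\,dt=\int_{B_R(o)}V(\varrho)\left|\nabla_G\left(\frac{u}{f(\varrho)}\right)\right|^2f(\varrho)^2\,dx\,dt,$$ and $$\int_{B_R(o)} V(\varrho)|\nabla_{\varrho,G} u|^2\,dx\,dt-\int_{B_R(o)}W(\varrho)u^2|\nabla_G \varrho|^2\,dx\,dt=\int_{B_R(o)}V(\varrho)\left|\nabla_{\varrho,G}\left(\frac{u}{f(\varrho)}\right)\right|^2f(\varrho)^2\,dx\,dt.$$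
   Context: Grushin space: fix an integer $n\ge 2$ and put $Q=n+2$ (homogeneous dimension). Points of $\mathbb{R}^{n+1}$ are written $(x,t)$ with $x\in\mathbb{R}^n$, $t\in\mathbb{R}$; $o$ is the origin; all functions are real-valued. The Grushin gradient is $\nabla_G u=(\nabla_x u,\ |x|\partial_t u)$, so $|\nabla_G u|^2=|\nabla_x u|^2+|x|^2(\partial_t u)^2$. The homogeneous norm is $\varrho(x,t)=(|x|^4+4t^2)^{1/4}$; it satisfies $|\nabla_G\varrho|^2=|x|^2/\varrho^2=:\psi$ away from $o$. For $0<R\le\infty$, $B_R(o)=\{(x,t):\varrho(x,t)<R\}$ (so $B_\infty(o)=\mathbb{R}^{n+1}$). The radial derivative (derivative in $\varrho$ in the polar coordinates $x=\varrho\sin^{1/2}\phi\, w$, $t=\frac{\varrho^2}{2}\cos\phi$, $w\in\mathbb{S}^{n-1}$, $0<\phi<\pi$) is $\partial_\varrho u=\frac1\varrho\left(\sum_{j=1}^n x_j\partial_{x_j}u+2t\,\partial_t u\right)$. The radial Grushin gradient is $\nabla_{\varrho,G}u=\psi^{1/2}(\partial_\varrho u,0,0)$, so $|\nabla_{\varrho,G}u|^2=\psi(\partial_\varrho u)^2$. Bessel pair: a pair $(V,W)$ of $C^1$ functions on $(0,R)$ is a $Q$-dimensional Bessel pair on $(0,R)$ with positive solution $f$ if the ODE $(r^{Q-1}V(r)y')'+r^{Q-1}W(r)y=0$ has the positive solution $y=f$ on $(0,R)$ (in the classical sense). *)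

(* Defs.v *)
From HB Require Import structures.
From mathcomp Require Import all_boot all_order all_algebra.
From mathcomp Require Import all_classical all_reals all_analysis.
Import Order.TTheory GRing.Theory Num.Theory.
Import numFieldNormedType.Exports.

Set Implicit Arguments.
Unset Strict Implicit.
Unset Printing Implicit Defensive.

Local Open Scope classical_set_scope.
Local Open Scope ring_scope.

Section measurable_rV.
Context {R : realType}.

(* The sigma-algebra on R^n generated by the coordinates, as in the library for
   n.-tuple. *)
Definition rV_coord n (i : 'I_n) (v : 'rV[R]_n) : measurableTypeR R := v 0 i.

Let rV_set0 n : g_sigma_preimage (@rV_coord n) set0.
Proof. exact: sigma_algebra0. Qed.

Let rV_setC n A :
  g_sigma_preimage (@rV_coord n) A -> g_sigma_preimage (@rV_coord n) (~` A).
Proof. exact: sigma_algebraC. Qed.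

Let rV_bigcup n (F : (set 'rV[R]_n)^nat) :
  (forall i, g_sigma_preimage (@rV_coord n) (F i)) ->
  g_sigma_preimage (@rV_coord n) (\bigcup_i (F i)).
Proof. exact: sigma_algebra_bigcup. Qed.

HB.instance Definition _ n := @isMeasurable.Build default_measure_display
  'rV[R]_n (g_sigma_preimage (@rV_coord n)) (@rV_set0 n) (@rV_setC n)
  (@rV_bigcup n).

Lemma measurable_fun_rVP d (T : measurableType d) n (f : T -> 'rV[R]_n) :
  measurable_fun [set: T] f <->
  forall i, measurable_fun [set: T] (rV_coord i \o f).
Proof.
split=> [mf i|mf].
  apply: measurableT_comp => // _ Y mY; rewrite setTI.
  apply: sub_sigma_algebra; rewrite -bigcup_seq/=; exists i => /=.
    by rewrite mem_index_enum.
  by exists Y => //; rewrite setTI.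
suff H : g_sigma_preimage (fun i => rV_coord i \o f) `<=` measurable.
  move=> _ A mA; apply: H; rewrite g_sigma_preimage_comp.
  by exists A.
apply: smallest_sub; first exact: sigma_algebra_measurable.
rewrite -bigcup_seq; apply: bigcup_sub => i _ A [B mB <-].
exact: mf.
Qed.

End measurable_rV.

Section lebesgue_rV.
Context {R : realType}.

Definition rV_cons n (p : measurableTypeR R * 'rV[R]_n) : 'rV[R]_n.+1 :=
  row_mx (const_mx p.1 : 'rV[R]_1) p.2.

Definition rV_uncons n (v : 'rV[R]_n.+1) : measurableTypeR R * 'rV[R]_n :=
  (v 0 ord0, \row_j v 0 (lift ord0 j)).

Lemma rV_consE0 n (p : measurableTypeR R * 'rV[R]_n) :
  rV_cons p 0 ord0 = p.1.
Proof.
rewrite /rV_cons (_ : ord0 = lshift n (ord0 : 'I_1)); last exact: val_inj.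
by rewrite (row_mxEl (const_mx p.1 : 'rV[R]_1) p.2) mxE.
Qed.

Lemma rV_consES n (p : measurableTypeR R * 'rV[R]_n) (j : 'I_n) :
  rV_cons p 0 (lift ord0 j) = p.2 0 j.
Proof.
rewrite /rV_cons (_ : lift ord0 j = rshift 1 j); last exact: val_inj.
by rewrite (row_mxEr (const_mx p.1 : 'rV[R]_1) p.2).
Qed.

Lemma rV_consK n : cancel (@rV_cons n) (@rV_uncons n).
Proof.
move=> [r v]; rewrite /rV_uncons rV_consE0; congr pair.
by apply/rowP => j; rewrite mxE rV_consES.
Qed.

Lemma rV_unconsK n : cancel (@rV_uncons n) (@rV_cons n).
Proof.
move=> v; apply/rowP => i; have [j ->|->] := unliftP ord0 i.
  by rewrite rV_consES mxE.
by rewrite rV_consE0.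
Qed.

Lemma measurable_rV_coord n (i : 'I_n) :
  measurable_fun [set: 'rV[R]_n] (rV_coord i).
Proof. by have /measurable_fun_rVP := @measurable_id _ 'rV[R]_n setT; exact. Qed.

Lemma measurable_rV_cons n : measurable_fun setT (@rV_cons n).
Proof.
apply/measurable_fun_rVP => i; have [j ->|->] := unliftP ord0 i.
  rewrite (_ : _ \o _ = rV_coord j \o snd).
    exact: measurableT_comp (measurable_rV_coord j) measurable_snd.
  by apply/funext => p; rewrite /= /rV_coord rV_consES.
rewrite (_ : _ \o _ = fst); first exact: measurable_fst.
by apply/funext => p; rewrite /= /rV_coord rV_consE0.
Qed.

Lemma measurable_rV_uncons n : measurable_fun setT (@rV_uncons n).
Proof.
apply/measurable_fun_pairP; split; first exact: measurable_rV_coord.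
apply/measurable_fun_rVP => j.
rewrite (_ : _ \o _ = rV_coord (lift ord0 j)); first exact: measurable_rV_coord.
by apply/funext => v; rewrite /= /rV_coord mxE.
Qed.

Section product.
Context n (mu : {sigma_finite_measure set 'rV[R]_n -> \bar R}).

(* Lebesgue measure on R times mu, transported to R^(n+1) = R x R^n. *)
Definition rV_prod : set 'rV[R]_n.+1 -> \bar R :=
  pushforward (lebesgue_measure \x mu)%E (@rV_cons n).

Let rV_prod0 : rV_prod set0 = 0%E.
Proof. by rewrite /rV_prod /pushforward preimage_set0 measure0. Qed.

Let rV_prod_ge0 A : (0 <= rV_prod A)%E.
Proof. by rewrite /rV_prod /pushforward measure_ge0. Qed.

Let rV_prod_sigma_additive : semi_sigma_additive rV_prod.
Proof.
move=> F mF tF mUF; rewrite /rV_prod /pushforward preimage_bigcup.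
apply: measure_semi_sigma_additive.
- by move=> i; rewrite -[X in measurable X]setTI; exact: measurable_rV_cons.
- apply/trivIsetP => /= i j _ _ ij; rewrite -preimage_setI.
  by move/trivIsetP : tF => /(_ _ _ _ _ ij) ->//; rewrite preimage_set0.
- by rewrite -preimage_bigcup -[X in measurable X]setTI;
    exact: measurable_rV_cons.
Qed.

HB.instance Definition _ := isMeasure.Build _ _ _ rV_prod
  rV_prod0 rV_prod_ge0 rV_prod_sigma_additive.

Let rV_prod_sigma_finite : sigma_finite setT rV_prod.
Proof.
have /sigma_finiteP[F [FT ndF Foo]] :=
  sigma_finiteT (lebesgue_measure : {sigma_finite_measure set _ -> \bar R}).
have /sigma_finiteP[G [GT ndG Goo]] := sigma_finiteT mu.
exists (fun i => @rV_uncons n @^-1` (F i `*` G i)).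
  rewrite -preimage_bigcup (_ : \bigcup_i _ = setT) ?preimage_setT//.
  rewrite -subTset -setXTT FT GT => -[x y] /= [[i _ Fx] [j _ Gy]].
  exists (maxn i j) => //; split.
  - by move: x Fx; exact/subsetPset/ndF/leq_maxl.
  - by move: y Gy; exact/subsetPset/ndG/leq_maxr.
move=> i; have [mFi Fioo] := Foo i; have [mGi Gioo] := Goo i; split.
  rewrite -[X in measurable X]setTI; apply: measurable_rV_uncons => //.
  exact: measurableX.
rewrite /rV_prod /pushforward -comp_preimage.
rewrite (_ : _ \o _ = id) ?preimage_id; last first.
  by apply/funext => p; exact: rV_consK.
by rewrite product_measure1E// lte_mul_pinfty// ge0_fin_numE.
Qed.

HB.instance Definition _ := Measure_isSigmaFinite.Build _ _ _ rV_prod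
  rV_prod_sigma_finite.

End product.

(* Lebesgue measure on R^n, as the n-fold product of lebesgue_measure. *)
Fixpoint lebesgue_rV n : {sigma_finite_measure set 'rV[R]_n -> \bar R} :=
  match n with
  | 0 => \d_(0 : 'rV[R]_0)
  | m.+1 => rV_prod (lebesgue_rV m)
  end.

Lemma lebesgue_rV_box n (A : 'I_n -> set (measurableTypeR R)) :
  (forall i, measurable (A i)) ->
  lebesgue_rV n [set v | forall i, A i (rV_coord i v)] =
  (\prod_(i < n) lebesgue_measure (A i))%E.
Proof.
elim: n A => [|n ih] A mA.
  by rewrite big_ord0 /= diracE mem_set// => -[].
rewrite big_ord_recl /= /rV_prod /pushforward.
rewrite -(ih (fun i => A (lift ord0 i)))//.
rewrite -product_measure1E//; last first.
  rewrite (_ : [set v | _] = \bigcap_i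
      (if insub i is Some j then rV_coord j @^-1` A (lift ord0 j) else setT)).
    apply: bigcapT_measurable => i; case: insubP => //= j _ _.
    by rewrite -[X in measurable X]setTI; exact: measurable_rV_coord.
  apply/seteqP; split=> v /= Hv.
    by move=> i _; case: insubP => //= j _ _; exact: Hv.
  by move=> i; have := Hv i Logic.I; rewrite valK.
congr (product_measure1 _ _ _); apply/seteqP; split=> p /=.
  move=> Hp; split; first by have := Hp ord0; rewrite /rV_coord rV_consE0.
  by move=> i; have := Hp (lift ord0 i); rewrite /rV_coord rV_consES.
move=> [Hp0 Hp] i; have [j ->|->] := unliftP ord0 i.
  by rewrite /rV_coord rV_consES; exact: Hp.
by rewrite /rV_coord rV_consE0.
Qed.

End lebesgue_rV.

Section grushin.
Context {R : realType}.

Definition sqnorm n (x : 'rV[R]_n) : R := \sum_i x 0 i ^+ 2.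

Definition enorm n (x : 'rV[R]_n) : R := Num.sqrt (sqnorm x).

Definition homdim (n : nat) : nat := (n + 2)%N.

Definition grushin_norm n (p : 'rV[R]_n * R) : R :=
  (enorm p.1 ^+ 4 + 4 * p.2 ^+ 2) `^ (4^-1).

Definition gball n (rad : \bar R) : set ('rV[R]_n * R) :=
  [set p | ((grushin_norm p)%:E < rad)%E].

Definition partial_x n (i : 'I_n) (u : 'rV[R]_n * R -> R) (p : 'rV[R]_n * R) : R :=
  'D_(delta_mx 0 i, 0) u p.

Definition partial_t n (u : 'rV[R]_n * R -> R) (p : 'rV[R]_n * R) : R :=
  'D_(0, 1) u p.

Definition grushin_grad n (u : 'rV[R]_n * R -> R) (p : 'rV[R]_n * R) :
    'rV[R]_n * R :=
  (\row_i partial_x i u p, enorm p.1 * partial_t u p).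

Definition sqnorm_grad n (v : 'rV[R]_n * R) : R := sqnorm v.1 + v.2 ^+ 2.

Definition grushin_psi n (p : 'rV[R]_n * R) : R :=
  enorm p.1 ^+ 2 / grushin_norm p ^+ 2.

Definition radial_deriv n (u : 'rV[R]_n * R -> R) (p : 'rV[R]_n * R) : R :=
  (grushin_norm p)^-1 *
  (\sum_i p.1 0 i * partial_x i u p + 2 * p.2 * partial_t u p).

(* Components along the polar frame (rho, phi, w), w being the spherical part. *)
Definition radial_grad n (u : 'rV[R]_n * R -> R) (p : 'rV[R]_n * R) :
    R * R * 'rV[R]_n :=
  (Num.sqrt (grushin_psi p) * radial_deriv u p, 0, 0).

Definition sqnorm_polar n (v : R * R * 'rV[R]_n) : R :=
  v.1.1 ^+ 2 + v.1.2 ^+ 2 + sqnorm v.2.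

Fixpoint is_Ck n (k : nat) (u : 'rV[R]_n * R -> R) : Prop :=
  match k with
  | 0 => continuous u
  | k'.+1 => (forall p, differentiable u p) /\ forall v, is_Ck k' ('D_v u)
  end.

Definition smooth n (u : 'rV[R]_n * R -> R) : Prop := forall k, is_Ck k u.

(* Elements of C_c^oo(Omega) are identified with their extensions by zero. *)
Definition Cc_smooth n (Omega : set ('rV[R]_n * R)) (u : 'rV[R]_n * R -> R) :
    Prop :=
  let supp := closure [set p | u p != 0] in
  [/\ smooth u, compact supp & supp `<=` Omega].

Definition radii (rad : \bar R) : set R := [set r | 0 < r /\ (r%:E < rad)%E].

Definition C1_on (I : set R) (g : R -> R) : Prop :=
  forall r, I r -> derivable g r 1 /\ {for r, continuous (derive1 g)}.

(* Classical solution: y and its quasi-derivative r^(Q-1) V y' are C^1 on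
   (0, rad); continuity of (r^(Q-1) V y')' is implied by the equation. *)
Definition bessel_solution (Q : nat) (rad : \bar R) (V W y : R -> R) : Prop :=
  let flux r := r ^+ Q.-1 * V r * derive1 y r in
  C1_on (radii rad) y /\
  forall r, radii rad r ->
    derivable flux r 1 /\ derive1 flux r + r ^+ Q.-1 * W r * y r = 0.

Definition bessel_pair (Q : nat) (rad : \bar R) (V W f : R -> R) : Prop :=
  [/\ C1_on (radii rad) V, C1_on (radii rad) W,
      bessel_solution Q rad V W f & forall r, radii rad r -> 0 < f r].

(* Lebesgue measure dx dt on R^n x R. *)
Definition lebesgue_xt n : {measure set ('rV[R]_n * measurableTypeR R) -> \bar R} :=
  (lebesgue_rV n \x lebesgue_measure)%E.

End grushin.

(* Main.v *)
Require Import Defs.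
From mathcomp Require Import all_boot all_order all_algebra.
From mathcomp Require Import all_classical all_reals all_analysis.
From mathcomp Require Import measurable_realfun lebesgue_integral_under.
From mathcomp Require Import ring lra.
Import Order.TTheory GRing.Theory Num.Theory.
Import numFieldNormedType.Exports.

Set Implicit Arguments.
Unset Strict Implicit.
Unset Printing Implicit Defensive.

Local Open Scope classical_set_scope.
Local Open Scope ring_scope.

(** Let G = r^(Q-1) V f'/f, let psi = |x|^2/rho^2 and let
    E = sum_j x_j d/dx_j + 2 t d/dt generate the dilations (l x, l^2 t).
    Expanding the square on the right-hand side and using the Riccati form
    G' = - r^(Q-1) (W + V (f'/f)^2) of the Bessel equation, in each of the two
    identities the left integrand minus the right one equals pointwise
    psi rho^(-Q) E(u^2 G(rho)).  The weight psi rho^(-Q) is homogeneous of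
    degree -Q and Lebesgue measure scales with factor l^Q, so the integral of
    psi rho^(-Q) (u^2 G(rho))(l x, l^2 t) does not depend on l; differentiating
    it at l = 1 under the integral sign shows that the integral of
    psi rho^(-Q) E(u^2 G(rho)) vanishes. *)

(** * Lebesgue measure and anisotropic dilations *)

Section dilation_measure.
Context {R : realType}.
Local Open Scope ereal_scope.

Lemma measurable_scale (c : R) :
  measurable_fun [set: measurableTypeR R] ( *%R c : R -> measurableTypeR R).
Proof. exact: measurable_funM. Qed.

(** By uniqueness of Lebesgue measure: [c] times the push-forward under multiplication by [c] gives
    each half-open interval its length. *)
Lemma lebesgue_measure_scale (c : R) (A : set (measurableTypeR R)) :
  (0 < c)%R -> measurable A ->
  lebesgue_measure (( *%R c : R -> measurableTypeR R) @^-1` A) =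
  c^-1%:E * lebesgue_measure A.
Proof.
move=> c0 mA.
unshelve epose (nu := mscale (NngNum (ltW c0)) (pushforward lebesgue_measure
    ( *%R c : measurableTypeR R -> measurableTypeR R))
    : {measure set (measurableTypeR R) -> \bar R}).
  exact: measurable_scale.
have -> : lebesgue_measure A = nu A.
  apply: lebesgue_measure_unique mA => _ [[a b]] /= _ <-.
  rewrite /nu/= /mscale/= /pushforward/=.
  rewrite (_ : _ @^-1` _ = `]c^-1 * a, c^-1 * b]%classic)%R; last first.
    apply/seteqP; split => x /=; rewrite !in_itv/=.
      by rewrite ler_pdivlMl// ltr_pdivrMl.
    by rewrite ler_pdivlMl// ltr_pdivrMl.
  rewrite !lebesgue_measure_itv/= !lte_fin ltr_pM2l ?invr_gt0//.
  case: ifPn => _; last by rewrite mule0.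
  by rewrite -!EFinD -EFinM -mulrBr mulrA mulfV ?gt_eqF// mul1r.
by rewrite /nu/= /mscale/= muleA -EFinM mulVf ?gt_eqF// mul1e.
Qed.

Lemma ge0_integral_lebesgue_scale (c : R) (f : measurableTypeR R -> \bar R) :
  (0 < c)%R -> measurable_fun setT f -> (forall x, 0 <= f x) ->
  \int[lebesgue_measure]_x f (c * x)%R =
  c^-1%:E * \int[lebesgue_measure]_x f x.
Proof.
move=> c0 mf f0; have c0' : (0 <= c^-1)%R by rewrite invr_ge0 ltW.
rewrite -[LHS](@ge0_integral_pushforward _ _ _ (measurableTypeR R) _ _
  (measurable_scale c) _ setT)//.
rewrite -(@ge0_integral_mscale _ _ _ _ _ measurableT (NngNum c0'))//.
apply: eq_measure_integral => A mA _ /=.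
by rewrite /pushforward /mscale/= lebesgue_measure_scale.
Qed.

Lemma measurable_rV_scale n (c : R) :
  measurable_fun setT (fun v : 'rV[R]_n => c *: v).
Proof.
apply/measurable_fun_rVP => i.
rewrite (_ : _ \o _ = ( *%R c : measurableTypeR R -> measurableTypeR R) \o rV_coord i).
  exact: measurableT_comp (measurable_scale c) (measurable_rV_coord i).
by apply/funext => v; rewrite /= /rV_coord mxE.
Qed.

Lemma rV_cons_scale n (c : R) (p : measurableTypeR R * 'rV[R]_n) :
  c *: rV_cons p = rV_cons ((c * p.1)%R : measurableTypeR R, c *: p.2).
Proof.
apply/rowP => i; rewrite mxE; have [j ->|->] := unliftP ord0 i.
  by rewrite !rV_consES mxE.
by rewrite !rV_consE0.
Qed.

(** [lebesgue_rV] is a push-forward of a product measure, so Tonelli peels off the first coordinate;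
    this drives inductions on the dimension. *)
Lemma ge0_integral_rV_cons n (f : 'rV[R]_n.+1 -> \bar R) :
  measurable_fun setT f -> (forall v, 0 <= f v) ->
  \int[lebesgue_rV n.+1]_v f v =
  \int[lebesgue_measure]_x \int[lebesgue_rV n]_v f (rV_cons (x, v)).
Proof.
move=> mf f0.
rewrite -(@fubini_tonelli1 _ _ _ _ _ lebesgue_measure (lebesgue_rV n)
  (f \o @rV_cons R n))//=; last first.
 by apply: measurableT_comp => //; exact: measurable_rV_cons.
exact: (@ge0_integral_pushforward _ _ _ _ _ _ (@measurable_rV_cons R n) _ setT).
Qed.

(** Induction on [n]: the inner integral contributes [c ^- n], the first coordinate one more factor
    [c^-1]. *)
Lemma ge0_integral_rV_scale n (c : R) (f : 'rV[R]_n -> \bar R) :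
  (0 < c)%R -> measurable_fun setT f -> (forall v, 0 <= f v) ->
  \int[lebesgue_rV n]_v f (c *: v) =
  (c ^- n)%:E * \int[lebesgue_rV n]_v f v.
Proof.
move=> c0; elim: n f => [|n ih] f mf f0.
  by rewrite expr0 invr1 mul1e; apply: eq_integral => v _; congr f;
    apply/rowP => -[].
have mfc x : measurable_fun setT (fun v => f (rV_cons (x, v))).
  apply: measurableT_comp => //; apply: measurableT_comp.
    exact: measurable_rV_cons.
  exact: measurable_pair1.
rewrite !ge0_integral_rV_cons//; last first.
  by apply: measurableT_comp => //; exact: measurable_rV_scale.
pose g (x : measurableTypeR R) := \int[lebesgue_rV n]_v f (rV_cons (x, v)).
have mg : measurable_fun setT g.
  apply: (@measurable_fun_fubini_tonelli_F _ _ _ _ _ (lebesgue_rV n)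
    (f \o @rV_cons R n)) => [|p]; last exact: f0.
  by apply: measurableT_comp => //; exact: measurable_rV_cons.
have g0 x : 0 <= g x by exact: integral_ge0.
transitivity (\int[lebesgue_measure]_x ((c ^- n)%:E * g (c * x)%R)).
  apply: eq_integral => x _; rewrite -ih//.
  by apply: eq_integral => v _; rewrite rV_cons_scale.
rewrite (@ge0_integralZl _ _ _ lebesgue_measure setT measurableT
  (fun x => g (c * x)%R)); last 3 first.
- by apply: (@measurableT_comp _ _ _ _ _ _ g) => //; exact: measurable_scale.
- by move=> x _; exact: g0.
- by rewrite lee_fin invr_ge0 exprn_ge0// ltW.
by rewrite ge0_integral_lebesgue_scale// muleA -EFinM exprSr invfM.
Qed.

(** The variable t has weight 2, which makes [grushin_norm] homogeneous of degree 1 for [c >= 0]. *)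
Definition grushin_dil n (c : R) (p : 'rV[R]_n * measurableTypeR R) :
    'rV[R]_n * measurableTypeR R :=
  (c *: p.1, (c ^+ 2 * p.2)%R).

Lemma measurable_grushin_dil n (c : R) : measurable_fun setT (@grushin_dil n c).
Proof.
apply/measurable_fun_pairP; split.
  exact: measurableT_comp (@measurable_rV_scale n c) measurable_fst.
exact: measurableT_comp (measurable_scale (c ^+ 2)) measurable_snd.
Qed.

(** The factor [c ^- n] comes from x and [c ^- 2] from t; together they give the homogeneous
    dimension. *)
Lemma ge0_integral_xt_dil n (c : R)
    (f : 'rV[R]_n * measurableTypeR R -> \bar R) :
  (0 < c)%R -> measurable_fun setT f -> (forall p, 0 <= f p) ->
  \int[lebesgue_xt n]_p f (grushin_dil c p) =
  (c ^- homdim n)%:E * \int[lebesgue_xt n]_p f p.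
Proof.
move=> c0 mf f0; have c20 : (0 < c ^+ 2)%R by rewrite exprn_gt0.
rewrite /lebesgue_xt !fubini_tonelli1//; last first.
  by apply: measurableT_comp => //; exact: measurable_grushin_dil.
rewrite /fubini_F/=.
pose g (v : 'rV[R]_n) := \int[lebesgue_measure]_t f (v, t).
have mg : measurable_fun setT g.
  exact: (@measurable_fun_fubini_tonelli_F _ _ _ _ _ lebesgue_measure f).
have g0 x : 0 <= g x by exact: integral_ge0.
transitivity (\int[lebesgue_rV n]_v ((c ^- 2)%:E * g (c *: v))).
  apply: eq_integral => v _; rewrite -ge0_integral_lebesgue_scale//.
  by apply: measurableT_comp => //; exact: measurable_pair1.
rewrite (@ge0_integralZl _ _ _ (lebesgue_rV n) setT measurableT
  (fun v => g (c *: v))); last 3 first.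
- by apply: (@measurableT_comp _ _ _ _ _ _ g) => //; exact: measurable_rV_scale.
- by move=> v _; exact: g0.
- by rewrite lee_fin invr_ge0 ltW.
by rewrite ge0_integral_rV_scale// muleA -EFinM -invfM -exprD addnC.
Qed.

Lemma integral_xt_dil n (c : R) (f : 'rV[R]_n * measurableTypeR R -> \bar R) :
  (0 < c)%R -> (lebesgue_xt n).-integrable setT f ->
  \int[lebesgue_xt n]_p f (grushin_dil c p) =
  (c ^- homdim n)%:E * \int[lebesgue_xt n]_p f p.
Proof.
move=> c0 fi; have mf := measurable_int _ fi.
transitivity (\int[lebesgue_xt n]_p f^\+ (grushin_dil c p) -
              \int[lebesgue_xt n]_p f^\- (grushin_dil c p)).
  rewrite integralE -[fun p => f _]/(f \o grushin_dil c).
  by rewrite funepos_comp funeneg_comp.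
rewrite [in RHS]integralE.
rewrite [X in X - _]ge0_integral_xt_dil//; last exact: measurable_funepos.
rewrite [X in _ - X]ge0_integral_xt_dil//; last exact: measurable_funeneg.
(* Distributing over the difference of the two parts is legitimate because the integral of the
   negative part is finite. *)
rewrite [RHS]muleBr//; apply: fin_num_adde_defl.
by rewrite fin_numN integrable_neg_fin_num.
Qed.

Lemma Rintegral_xt_dil n (c : R) (f : 'rV[R]_n * measurableTypeR R -> R) :
  (0 < c)%R -> (lebesgue_xt n).-integrable setT (EFin \o f) ->
  (\int[lebesgue_xt n]_p f (grushin_dil c p) =
   c ^- homdim n * \int[lebesgue_xt n]_p f p)%R.
Proof.
move=> c0 fi; rewrite /Rintegral (@integral_xt_dil n c (EFin \o f))//.
by rewrite fineM// integrable_fin_num.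
Qed.

End dilation_measure.

(** * Measurability of open sets and integrability on boxes *)

Section integrability.
Context {R : realType}.

Let XT n : measurableType _ := ('rV[R]_n * measurableTypeR R)%type.

Let rbox n (q : 'rV[R]_n * R) (e : R) : set ('rV[R]_n * R) :=
  [set p : 'rV[R]_n * R | (forall i, `|p.1 0 i - q.1 0 i| < e) /\ `|p.2 - q.2| < e].

Lemma measurable_rV_box n (A : 'I_n -> set (measurableTypeR R)) :
  (forall i, measurable (A i)) ->
  measurable [set v : 'rV[R]_n | forall i, A i (rV_coord i v)].
Proof.
move=> mA.
rewrite (_ : [set v | _] = \bigcap_(i in [set: 'I_n]) (rV_coord i @^-1` A i)).
  apply: fin_bigcap_measurable => // i _.
  by rewrite -[X in measurable X]setTI; exact: measurable_rV_coord.
by apply/seteqP; split=> v /= Hv i *; exact: Hv.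
Qed.

Lemma measurable_rbox n (q : 'rV[R]_n * R) (e : R) :
  measurable (rbox q e : set (XT n)).
Proof.
rewrite (_ : rbox q e =
  [set v : 'rV[R]_n | forall i, `]q.1 0 i - e, q.1 0 i + e[%classic (rV_coord i v)]
  `*` (`]q.2 - e, q.2 + e[%classic : set (measurableTypeR R))).
  apply: measurableX; last exact: measurable_itv.
  apply: (@measurable_rV_box n (fun i => `]q.1 0 i - e, q.1 0 i + e[%classic)).
  by move=> i; exact: measurable_itv.
apply/seteqP; split=> -[v t] /= [H1 H2]; split.
- by move=> i; rewrite /= in_itv/= -ltr_distl; exact: H1.
- by rewrite in_itv/= -ltr_distl.
- by move=> i; have := H1 i; rewrite /= in_itv/= -ltr_distl.
- by move: H2; rewrite in_itv/= -ltr_distl.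
Qed.

(** The sigma-algebra is generated by coordinates, not by open sets, so second countability enters:
    [U] is the union of the countably many rational boxes that it contains. *)
Lemma open_measurable_xt n (U : set ('rV[R]_n * R)) :
  open U -> measurable (U : set (XT n)).
Proof.
move=> oU.
(* An index stores a rational centre and a natural number [k]; the half-side of the box is
   [k.+1%:R^-1]. *)
pose J := ('rV[rat]_n * rat * nat)%type.
pose B (j : J) := rbox (map_mx ratr j.1.1 : 'rV[R]_n, ratr j.1.2) j.2.+1%:R^-1.
pose F k := if unpickle k is Some j then
  (if `[< B j `<=` U >] then B j else set0) else set0.
rewrite (_ : U = \bigcup_k F k).
  apply: bigcupT_measurable => k; rewrite /F; case: unpickle => [j|]; last exact: measurable0.
  by case: ifP => _; [exact: measurable_rbox|exact: measurable0].
apply/seteqP; split=> [p Up|p [k _]]; last first.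
  by rewrite /F; case: unpickle => // j; case: ifP => // /asboolP; exact.
have /nbhs_ballP[e /= e0 eU] : nbhs p U by exact: open_nbhs_nbhs.
(* Two points of a box are compared through its centre, hence half of [e]. *)
have [k] : exists k, k.+1%:R^-1 < e / 2 :> R.
  have := @ltr_add_invr R 0 (e / 2).
  by rewrite divr_gt0// => /(_ isT)[k]; rewrite add0r; exists k.
move=> ke.
have k0 : 0 < k.+1%:R^-1 :> R by rewrite invr_gt0.
have rap (x : R) : exists q : rat, `|x - ratr q| < k.+1%:R^-1.
  have := @rat_in_itvoo R (x - k.+1%:R^-1) (x + k.+1%:R^-1).
  case; first by rewrite ltrBlDr -addrA ltrDl addr_gt0.
  by move=> q; rewrite in_itv/= -ltr_distl distrC; exists q.
have [qx Hqx] := choice (fun i => rap (p.1 0 i)).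
have [qt Hqt] := rap p.2.
pose j : J := ((\row_i qx i, qt), k).
have Bp : B j p by split=> //= i; rewrite !mxE.
exists (pickle j) => //; rewrite /F pickleK; case: ifPn => // /asboolP; case.
move=> y [yx yt]; apply: eU.
have tri (a b c : R) :
    `|a - c| < k.+1%:R^-1 -> `|b - c| < k.+1%:R^-1 -> `|a - b| < e.
  move=> ac bc; rewrite -(subrKA c) (le_lt_trans (ler_normD _ _))//.
  by rewrite (distrC c) (splitr e) ltrD// (lt_trans _ ke).
split; last exact: tri (Hqt) yt.
split=> // i j'; rewrite (ord1 i); apply: tri (Hqx j') _.
by have := yx j'; rewrite !mxE.
Qed.

Lemma continuous_measurable_xt n (F : 'rV[R]_n * R -> R) :
  continuous F -> measurable_fun setT (F : XT n -> R).
Proof.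
move=> cF; apply: (measurability _ (RGenOpens.measurableE R)).
move=> _ [_ [a [b ->]] <-]; rewrite setTI; apply: open_measurable_xt.
by apply: open_comp => // p _; exact: cF.
Qed.

(** These cubes have finite measure; they serve to enclose supports and to build integrable
    majorants. *)
Definition xt_box n (L : R) : set ('rV[R]_n * R) :=
  [set p : 'rV[R]_n * R | (forall i, `|p.1 0 i| <= L) /\ `|p.2| <= L].

Lemma xt_boxE n (L : R) : @xt_box n L =
  [set v : 'rV[R]_n | forall i, `[- L, L]%classic (rV_coord i v)]
  `*` (`[- L, L]%classic : set (measurableTypeR R)).
Proof.
apply/seteqP; split=> -[v t] /= [H1 H2]; split.
- by move=> i; rewrite /= in_itv/= -ler_norml; exact: H1.
- by rewrite in_itv/= -ler_norml.
- by move=> i; have := H1 i; rewrite /= in_itv/= -ler_norml.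
- by move: H2; rewrite in_itv/= -ler_norml.
Qed.

Lemma measurable_xt_box n (L : R) : measurable (@xt_box n L : set (XT n)).
Proof.
rewrite xt_boxE; apply: measurableX; last exact: measurable_itv.
apply: (@measurable_rV_box n (fun=> `[- L, L]%classic)) => i.
exact: measurable_itv.
Qed.

Lemma lebesgue_xt_box_lty n (L : R) : (lebesgue_xt n (@xt_box n L) < +oo)%E.
Proof.
rewrite xt_boxE /lebesgue_xt.
rewrite [ltLHS]product_measure1E; last 2 first.
- apply: (@measurable_rV_box n (fun=> `[- L, L]%classic)) => i.
  exact: measurable_itv.
- exact: measurable_itv.
have itvoo : (lebesgue_measure (`[(- L)%R, L]%classic : set (measurableTypeR R)) < +oo)%E.
  by rewrite lebesgue_measure_itv/=; case: ifP; rewrite -?EFinD ltry.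
apply: lte_mul_pinfty => //.
have boxE := @lebesgue_rV_box R n (fun=> `[- L, L]%classic)
  (fun=> measurable_itv _).
by rewrite [X in X \is a fin_num]boxE prode_fin_num// => i _; rewrite ge0_fin_numE.
Qed.

Lemma integrable_indic_lty d (T : measurableType d)
    (mu : {measure set T -> \bar R}) (A : set T) (M : R) :
  measurable A -> (mu A < +oo)%E ->
  mu.-integrable setT (EFin \o (fun p => M * \1_A p)).
Proof.
move=> mA Aoo.
apply: (@integrableZl _ _ _ mu setT measurableT M (EFin \o \1_A)).
apply/integrableP; split; first exact/measurable_EFinP.
rewrite (eq_integral (EFin \o \1_A)); last first.
  by move=> t _; rewrite /= ger0_norm.
by rewrite integral_indic// setIT.
Qed.

(** Domination by [M] times the indicator of the cube. *)
Lemma integrable_xt_cc n (F : 'rV[R]_n * R -> R) (L M : R) :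
  continuous F -> (forall p, `|F p| <= M) ->
  (forall p, F p != 0 -> @xt_box n L p) ->
  (lebesgue_xt n).-integrable setT (EFin \o F).
Proof.
move=> cF FM FL.
have := @integrable_indic_lty _ _ (lebesgue_xt n) _ M (@measurable_xt_box n L)
  (@lebesgue_xt_box_lty n L).
apply: le_integrable => //.
  by apply/measurable_EFinP; exact: continuous_measurable_xt.
move=> p _ /=; rewrite lee_fin indicE.
have M0 : 0 <= M by exact: le_trans (FM 0).
have [->|/FL pL] := eqVneq (F p) 0; first by rewrite normr0.
by rewrite mem_set// mulr1 (ger0_norm M0).
Qed.

End integrability.

(** * The homogeneous norm *)

Section directional_derivatives.
Context {R : realType}.

Lemma derive_line (V : normedModType R) (F : V -> R) (p v : V) :
  'D_1 (fun h : R => F (h *: v + p)) 0 = 'D_v F p.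
Proof.
rewrite /derive; apply: (congr1 (fun d : R -> R => lim (d @ 0^'))).
by apply/funext => h /=; rewrite addr0 scale0r add0r [h%:A]mulr1.
Qed.

(** Restricting [F] to the line through [p] with direction [v] reduces this to the one-variable
    chain rule. *)
Lemma is_derive_comp1 (V : normedModType R) (g : R -> R) (F : V -> R) (p v : V)
    (dg dF : R) :
  is_derive p v F dF -> is_derive (F p) 1 g dg ->
  is_derive p v (g \o F) (dg * dF).
Proof.
move=> [dFp dFE].
have /derivable1P dF1 := dFp.
have F0 : F p = (fun h : R => F (h *: v + p)) 0 by rewrite scale0r add0r.
have D1 : is_derive (0 : R) 1 (fun h : R => F (h *: v + p)) dF.
  by split=> //; rewrite derive_line.
rewrite F0 => dg0.
have : is_derive (0 : R) 1 (fun h : R => (g \o F) (h *: v + p)) (dg * dF).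
  exact: (@is_derive1_comp _ g (fun h : R => F (h *: v + p)) 0 dg dF dg0 D1).
move=> [gFp gFE]; split; first exact/derivable1P.
by rewrite -derive_line.
Qed.

Lemma is_derive_affine (V : normedModType R) (F : V -> R) (p v : V) (a b : R) :
  (forall h : R, F (h *: v + p) = h * a + b) -> is_derive p v F a.
Proof.
move=> FE.
have : is_derive (0 : R) 1 (fun h : R => F (h *: v + p)) a.
  rewrite (_ : (fun h => _) = (id * cst a : R -> R) + cst b); last first.
    by apply/funext => h; rewrite FE.
  by apply: is_derive_eq; rewrite scaler0 add0r addr0 [LHS]mulr1.
by move=> [dF dE]; split; [exact/derivable1P|rewrite -derive_line].
Qed.

Lemma is_derive_coordx n (i : 'I_n) (p v : 'rV[R]_n * R) :
  is_derive p v (fun q : 'rV[R]_n * R => q.1 0 i) (v.1 0 i).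
Proof. by apply: (@is_derive_affine _ _ _ _ _ (p.1 0 i)) => h; rewrite !mxE. Qed.

Lemma is_derive_coordt n (p v : 'rV[R]_n * R) :
  is_derive p v (fun q : 'rV[R]_n * R => q.2) v.2.
Proof. exact: (@is_derive_affine _ _ _ _ _ p.2). Qed.

Lemma is_derive_sqnorm n (p v : 'rV[R]_n * R) :
  is_derive p v (fun q => sqnorm q.1) (2 * \sum_i p.1 0 i * v.1 0 i).
Proof.
rewrite (_ : (fun q => _) =
    \sum_(i < n) (fun q : 'rV[R]_n * R => q.1 0 i) ^+ 2); last first.
  by apply/funext => q; rewrite fct_sumE.
have H i : is_derive p v ((fun q : 'rV[R]_n * R => q.1 0 i) ^+ 2)
    (2 * (p.1 0 i * v.1 0 i)).
  apply: is_derive_eq; first exact/is_deriveX/is_derive_coordx.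
  by rewrite /= expr1 mulrA.
by rewrite mulr_sumr; exact: is_derive_sum.
Qed.

End directional_derivatives.

Section grushin_norm_theory.
Context {R : realType} (n : nat).
Implicit Types (p q v : 'rV[R]_n * R).
Local Notation rho := (@grushin_norm R n).

Lemma sqnorm_ge0 (x : 'rV[R]_n) : 0 <= sqnorm x.
Proof. by apply: sumr_ge0 => i _; exact: sqr_ge0. Qed.

Lemma enorm_sqr (x : 'rV[R]_n) : enorm x ^+ 2 = sqnorm x.
Proof. by rewrite sqr_sqrtr// sqnorm_ge0. Qed.

Lemma sqnorm_eq0 (x : 'rV[R]_n) : sqnorm x = 0 -> x = 0.
Proof.
move=> /eqP; rewrite psumr_eq0; last by move=> i _; exact: sqr_ge0.
move=> /allP H; apply/rowP => i; rewrite mxE.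
by apply/eqP; rewrite -sqrf_eq0; exact: H (mem_index_enum i).
Qed.

Lemma sqnormZ (c : R) (x : 'rV[R]_n) : sqnorm (c *: x) = c ^+ 2 * sqnorm x.
Proof.
by rewrite /sqnorm mulr_sumr; apply: eq_bigr => i _; rewrite mxE exprMn.
Qed.

(** The fourth power of the homogeneous norm, a polynomial in the coordinates. *)
Definition gauge4 p : R := sqnorm p.1 ^+ 2 + 4 * p.2 ^+ 2.

Lemma gauge4_ge0 p : 0 <= gauge4 p.
Proof. by apply: addr_ge0; [exact: sqr_ge0|apply: mulr_ge0; rewrite ?sqr_ge0]. Qed.

Lemma grushin_normE p : rho p = gauge4 p `^ 4^-1.
Proof. by rewrite /grushin_norm -[4%N]/(2 * 2)%N exprM enorm_sqr. Qed.

Lemma grushin_norm_ge0 p : 0 <= rho p.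
Proof. by rewrite grushin_normE powR_ge0. Qed.

Lemma grushin_norm4 p : rho p ^+ 4 = gauge4 p.
Proof.
rewrite grushin_normE -powR_mulrn ?powR_ge0// -powRrM mulVf ?powRr1//.
exact: gauge4_ge0.
Qed.

Lemma grushin_norm_eq0 p : rho p = 0 -> p = 0.
Proof.
move=> p0; have : gauge4 p = 0 by rewrite -grushin_norm4 p0 expr0n.
rewrite /gauge4 => N0.
have s0 := sqr_ge0 (sqnorm p.1); have t0 := sqr_ge0 p.2.
have /eqP : sqnorm p.1 ^+ 2 = 0 by lra.
have /eqP : p.2 ^+ 2 = 0 by lra.
rewrite !sqrf_eq0; case: p {p0 N0 s0 t0} => x t /= /eqP -> /eqP/sqnorm_eq0 ->.
by [].
Qed.

Lemma grushin_norm_gt0 p : p <> 0 -> 0 < rho p.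
Proof.
move=> p0; rewrite lt_neqAle grushin_norm_ge0 andbT eq_sym.
by apply/eqP => /grushin_norm_eq0.
Qed.

Lemma grushin_norm_dil (c : R) p : 0 <= c -> rho (grushin_dil c p) = c * rho p.
Proof.
move=> c0; rewrite !grushin_normE.
have -> : gauge4 (grushin_dil c p) = c ^+ 4 * gauge4 p.
  by rewrite /gauge4 /grushin_dil/= sqnormZ; ring.
by rewrite powRM ?exprn_ge0 ?gauge4_ge0// -powR_mulrn// -powRrM divff ?powRr1.
Qed.

Lemma continuous_coordx (i : 'I_n) : continuous (fun p => p.1 0 i).
Proof.
move=> q; apply: (@continuous_comp _ _ _ fst (fun x : 'rV[R]_n => x 0 i)).
  exact: cvg_fst.
exact: coord_continuous.
Qed.

Lemma continuous_sum (T : topologicalType) m (F : 'I_m -> T -> R) :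
  (forall i, continuous (F i)) -> continuous (fun x => \sum_i F i x).
Proof. by move=> cF; apply: continuous_big => // x; exact: add_continuous. Qed.

Lemma continuous_sqnorm : continuous (fun p => sqnorm p.1).
Proof.
apply: continuous_sum => i p.
by apply: (@cvgM _ _ _ _ (fun p : 'rV[R]_n * R => p.1 0 i));
  exact: continuous_coordx.
Qed.

Lemma continuous_gauge4 : continuous gauge4.
Proof.
move=> p; apply: cvgD; first by apply: cvgM; exact: continuous_sqnorm.
by apply: cvgM; [exact: cvg_cst|apply: cvgM; exact: cvg_snd].
Qed.

Lemma continuous_grushin_norm : continuous rho.
Proof.
(* As an iterated square root, the fourth root is continuous everywhere, including at 0. *)
have -> : rho = Num.sqrt \o (Num.sqrt \o gauge4).
  apply/funext => p; rewrite grushin_normE /= -!powR12_sqrt ?powR_ge0 ?gauge4_ge0//.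
  by rewrite -powRrM; congr (_ `^ _); lra.
move=> p; apply: continuous_comp; last exact: sqrt_continuous.
apply: continuous_comp; last exact: sqrt_continuous.
exact: continuous_gauge4.
Qed.

Lemma is_derive_gauge4 p v : is_derive p v gauge4
  (4 * (sqnorm p.1 * (\sum_i p.1 0 i * v.1 0 i) + 2 * p.2 * v.2)).
Proof.
rewrite (_ : gauge4 = (fun q : 'rV[R]_n * R => sqnorm q.1) ^+ 2 +
  cst 4 * (fun q : 'rV[R]_n * R => q.2) ^+ 2); last exact/funext.
have Dx := is_derive_sqnorm p v; have Dt := is_derive_coordt p v.
apply: is_derive_eq; rewrite scaler0 addr0 /= !expr1 /GRing.scale/=; ring.
Qed.

(** Chain rule for the fourth root of [gauge4], which is positive away from the origin. *)
Lemma is_derive_grushin_norm p v : p <> 0 ->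
  is_derive p v rho
    ((sqnorm p.1 * (\sum_i p.1 0 i * v.1 0 i) + 2 * p.2 * v.2) / rho p ^+ 3).
Proof.
move=> p0; have r0 := grushin_norm_gt0 p0.
have N0 : 0 < gauge4 p by rewrite -grushin_norm4 exprn_gt0.
rewrite [X in is_derive _ _ X](_ : rho = (fun x => x `^ 4^-1) \o gauge4); last first.
  by apply/funext => q; rewrite grushin_normE.
apply: is_derive_eq.
  apply: is_derive_comp1; first exact: is_derive_gauge4.
  exact: is_derive1_powR.
have -> : gauge4 p `^ (4^-1 - 1) = (rho p ^+ 3)^-1.
  rewrite -grushin_norm4 -!powR_mulrn ?grushin_norm_ge0// -powRrM -powRN.
  by congr (_ `^ _); lra.
by field; rewrite gt_eqF.
Qed.

End grushin_norm_theory.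

(** * Derivatives along dilations *)

Section dilation_derivative.
Context {R : realType} (n : nat).
Implicit Types (u : 'rV[R]_n * R -> R) (p q : 'rV[R]_n * R).

(** The field E of the overview; [radial_deriv] is its quotient by [grushin_norm]. *)
Definition euler_deriv u p : R :=
  \sum_i p.1 0 i * partial_x i u p + 2 * p.2 * partial_t u p.

(** Differentiability makes the directional derivative linear in the direction, which is expanded in
    the standard basis. *)
Lemma derive_partials u q (x : 'rV[R]_n) (t : R) : differentiable u q ->
  'D_(x, t) u q = \sum_i x 0 i * partial_x i u q + t * partial_t u q.
Proof.
move=> du; rewrite /partial_x /partial_t !deriveE//.
have -> : (x, t) = \sum_i x 0 i *: (delta_mx 0 i, 0) + t *: (0, 1)
    :> 'rV[R]_n * R.
  rewrite [X in X + _](_ : _ = (\sum_i x 0 i *: delta_mx 0 i, 0)); last first.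
    apply: (big_ind2 (fun (a : 'rV[R]_n * R) b => a = (b, 0))) => //.
      by move=> _ v _ w -> ->; congr pair; rewrite /= addr0.
    by move=> i _; congr pair; rewrite /= scaler0.
  by congr pair; rewrite /= ?scaler0 ?addr0 ?add0r -?row_sum_delta// [RHS]mulr1.
rewrite linearD linear_sum linearZ; congr (_ + _).
by apply: eq_bigr => i _; rewrite linearZ deriveE.
Qed.

(** The curve of dilations of (x, t) has velocity (x, 2 c t) at [c]. This is the field E at the
    dilated point (c x, c^2 t), divided by [c]. *)
Lemma is_derive_dil u p (c : R) : 0 < c -> differentiable u (grushin_dil c p) ->
  is_derive c 1 (fun l => u (grushin_dil l p))
    (euler_deriv u (grushin_dil c p) / c).
Proof.
move=> c0 du.
have dg : is_diff c (fun l : R => (l *: p.1, (l ^+ 2 * p.2)%R))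
   (fun h => (h *: p.1, (2 * c * h * p.2)%R)).
  have D1 := @is_diff_scalel R _ c p.1.
  have D2 : is_diff c (fun l : R => l ^+ 2 * p.2) (fun h => 2 * c * h * p.2).
    rewrite (_ : (fun l => _) = (id : R -> R) ^+ 2 * cst p.2)//.
    apply: is_diff_eq; apply/funext => h /=.
    rewrite scaler0 add0r expr1 -[LHS]/(p.2 * ((2 * c) * h)); ring.
  exact: (is_diff_pair D1 D2).
have dug : differentiable (fun l => u (grushin_dil l p)) c.
  by apply: (@differentiable_comp _ _ _ _ (fun l : R => grushin_dil l p) u).
split; first exact/derivable1_diffP.
rewrite deriveE//.
rewrite (@diff_comp _ _ _ _ (fun l : R => grushin_dil l p) u)//=.
rewrite [X in 'd u _ (X _)]diff_val -deriveE// derive_partials//.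
rewrite /euler_deriv [RHS]mulrDl mulr_suml; congr (_ + _); last first.
  by rewrite /=; field; rewrite gt_eqF.
apply: eq_bigr => i _; rewrite !mxE; field; by rewrite gt_eqF.
Qed.

End dilation_derivative.

(** * Functions vanishing off a compact subset of an open region *)

Section compact_support.
Context {R : realType} (n : nat).
Variables (Omega S : set ('rV[R]_n * R)).
Hypotheses (cS : compact S) (SO : S `<=` Omega) (clS : closed S).

(** A point outside the closed set [S] has a neighbourhood on which [F] is zero; the other points
    lie in [Omega]. *)
Lemma continuous_ext0 (F : 'rV[R]_n * R -> R) :
  (forall p, Omega p -> {for p, continuous F}) -> (forall p, ~ S p -> F p = 0) ->
  continuous F.
Proof.
move=> FO FS p; have [/SO/FO//|Sp] := pselect (S p).
apply: (near_cst_continuous 0).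
by apply: filterS (open_nbhs_nbhs (conj (closed_openC clS) Sp)) => q /FS.
Qed.

Lemma compact_box : exists2 L, 0 <= L & S `<=` @xt_box R n L.
Proof.
have [M [_ HM]] := compact_bounded cS.
(* Boundedness provides a bound by every number strictly above [M]; this choice is nonnegative as
   well. *)
exists (`|M| + 1) => [|p /HM Hp]; first by rewrite addr_ge0.
have {}Hp : `|p| <= `|M| + 1.
  by apply: Hp; rewrite (le_lt_trans (ler_norm M))// ltrDl.
move: Hp; rewrite prod_normE ge_max => /andP[px pt]; split => // i.
apply: le_trans px; rewrite -[leRHS]/(mx_norm p.1) mx_normrE.
exact: (le_bigmax _ (fun ij : 'I_1 * 'I_n => `|p.1 ij.1 ij.2|) (0, i)).
Qed.

Lemma continuous_cc_bounded (F : 'rV[R]_n * R -> R) :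
  continuous F -> (forall p, ~ S p -> F p = 0) ->
  exists M, forall p, `|F p| <= M.
Proof.
move=> cF FS.
have := @compact_bounded _ _ _ (continuous_compact (continuous_subspaceT cF) cS).
move=> [M [_ HM]]; exists (`|M| + 1) => p.
have [Sp|/FS->] := pselect (S p); last by rewrite normr0 addr_ge0.
apply: HM; last by exists p.
by rewrite (le_lt_trans (ler_norm M))// ltrDl.
Qed.

Lemma integrable_cc (F : 'rV[R]_n * R -> R) :
  (forall p, Omega p -> {for p, continuous F}) -> (forall p, ~ S p -> F p = 0) ->
  (lebesgue_xt n).-integrable setT (EFin \o F).
Proof.
move=> FO FS; have cF := continuous_ext0 FO FS.
have [M FM] := continuous_cc_bounded cF FS.
have [L _ SL] := compact_box.
apply: (@integrable_xt_cc _ _ _ L M) => // p Fp.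
by apply: SL; apply: contrapT => /FS /eqP; exact/negP.
Qed.

End compact_support.

(** * Differentiation of a dilation-invariant integral *)

Section dilation_invariance.
Context {R : realType} (n : nat).
Variables (w h H : 'rV[R]_n * R -> R) (L M : R).
Hypothesis w_hom : forall (c : R) p, 0 < c ->
  w (grushin_dil c p) = c ^- homdim n * w p.
Hypothesis dh : forall (c : R) p, 0 < c ->
  is_derive c 1 (fun l => h (grushin_dil l p)) (H (grushin_dil c p) / c).
(** Regularity is asked of the products: in the application the weight [w] is singular at the
    origin, while [h] and [H] vanish near it. *)
Let K p := w p * h p.
Let T p := w p * H p.
Hypotheses (cK : continuous K) (KM : forall p, `|K p| <= M)
  (KL : forall p, K p != 0 -> @xt_box R n L p).
Hypotheses (cT : continuous T) (TM : forall p, `|T p| <= M)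
  (TL : forall p, T p != 0 -> @xt_box R n L p).

Let half_gt0 (l : R) : l \in `]2^-1, 2[%R -> 0 < l.
Proof. by rewrite in_itv/= => /andP[l2 _]; lra. Qed.

(** Undoing a dilation with [l > 2^-1] enlarges x by a factor below 2 and t by a factor below 4; one
    cube of size [4 * L] thus works for all [l] near 1. *)
Let box_dil (l : R) p : l \in `]2^-1, 2[%R -> @xt_box R n L (grushin_dil l p) ->
  @xt_box R n (4 * L) p.
Proof.
move=> lI [/= bx bt]; have l0 := half_gt0 lI.
move: lI; rewrite in_itv/= => /andP[l1 _].
have L0 : 0 <= L by exact: le_trans bt.
split=> [i|].
  have := bx i; rewrite mxE normrM (gtr0_norm l0) => {}bx.
  have p0 := normr_ge0 (p.1 0 i); nra.
move: bt; rewrite normrM (gtr0_norm (exprn_gt0 2 l0)) => bt.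
have p0 := normr_ge0 p.2; have : 4^-1 <= l ^+ 2 by nra.
by move=> l4; nra.
Qed.

Let continuous_dil (l : R) :
  continuous (grushin_dil l : 'rV[R]_n * R -> 'rV[R]_n * R).
Proof.
move=> p.
have H1 : (fun q : 'rV[R]_n * R => l *: q.1) @ p --> l *: p.1.
  by apply: cvgZ; [exact: cvg_cst|exact: cvg_fst].
have H2 : (fun q : 'rV[R]_n * R => l ^+ 2 * q.2) @ p --> l ^+ 2 * p.2.
  by apply: cvgM; [exact: cvg_cst|exact: cvg_snd].
exact: (cvg_pair H1 H2).
Qed.

Let f (l : R) p := w p * h (grushin_dil l p).

Let fE (l : R) p : 0 < l -> f l p = l ^+ homdim n * K (grushin_dil l p).
Proof.
by move=> l0; rewrite /f /K w_hom// !mulrA mulfV ?mul1r// gt_eqF ?exprn_gt0.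
Qed.

Let integrable_dil (l : R) : l \in `]2^-1, 2[%R ->
  (lebesgue_xt n).-integrable setT (EFin \o (fun p => K (grushin_dil l p))).
Proof.
move=> lI; apply: (@integrable_xt_cc R n _ (4 * L) M) => [p|p|p /KL]; last exact: box_dil.
- by apply: (@continuous_comp _ _ _ (grushin_dil l) K); [exact: continuous_dil|exact: cK].
- exact: KM.
Qed.

Let integrable_f (l : R) : l \in `]2^-1, 2[%R ->
  (lebesgue_xt n).-integrable setT (EFin \o f l).
Proof.
move=> lI; have l0 := half_gt0 lI.
rewrite (_ : EFin \o f l =
    fun p => ((l ^+ homdim n)%:E * (K (grushin_dil l p))%:E)%E).
  by apply: integrableZl => //; exact: integrable_dil.
by apply/funext => p; rewrite /= fE// EFinM.
Qed.

(** The factor [l ^+ homdim n] from the homogeneity of [w] cancels the Jacobian of the dilation. *)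
Let integral_f (l : R) : l \in `]2^-1, 2[%R ->
  \int[lebesgue_xt n]_p f l p = \int[lebesgue_xt n]_p K p.
Proof.
move=> lI; have l0 := half_gt0 lI.
transitivity (\int[lebesgue_xt n]_p (l ^+ homdim n * K (grushin_dil l p))).
  by apply: eq_Rintegral => p _; rewrite fE.
rewrite RintegralZl//; last exact: integrable_dil.
rewrite Rintegral_xt_dil//; last exact: (@integrable_xt_cc R n _ L M).
by rewrite mulrA mulfV ?mul1r// gt_eqF ?exprn_gt0.
Qed.

(** Homogeneity of [w] gives [l ^+ homdim n], and [dh] divides by [l], hence the exponent lower by
    one. *)
Let derf (l : R) p : 0 < l ->
  is_derive l 1 (f^~ p) (l ^+ (homdim n).-1 * T (grushin_dil l p)).
Proof.
move=> l0; have dhl := dh p l0.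
rewrite /f (_ : (fun x => _) = w p \*: (fun l => h (grushin_dil l p)))//.
apply: is_derive_eq; rewrite /T w_hom//.
rewrite (_ : homdim n = (homdim n).-1.+1) ?exprS; last by rewrite /homdim addn2.
by rewrite /= /GRing.scale/=; field; rewrite expf_neq0 gt_eqF.
Qed.

(* [\int w * (h \o grushin_dil l)] does not depend on [l], and its derivative
   at [l = 1] is [\int w * H]. *)
Lemma integral_dilation_derivative0 : \int[lebesgue_xt n]_p (w p * H p) = 0.
Proof.
have I1 : (1 : R) \in `]2^-1, 2[%R by rewrite in_itv/=; apply/andP; split; lra.
(* A majorant of the derivative uniform over [l] between 1/2 and 2: the power of [l] is at most
   [2 ^+ homdim n], [T] is at most [M], and [box_dil] locates the support. *)
pose G p := 2 ^+ (homdim n) * M * \1_(@xt_box R n (4 * L)) p.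
have M0 : 0 <= M by exact: le_trans (TM 0).
have G0 p : 0 <= G p by rewrite !mulr_ge0.
have intG : (lebesgue_xt n).-integrable setT (EFin \o G).
  by apply: integrable_indic_lty; [exact: measurable_xt_box|exact: lebesgue_xt_box_lty].
have D l p : 0 < l ->
    partial1of2 f l p = l ^+ (homdim n).-1 * T (grushin_dil l p).
  by move=> l0; rewrite partial1of2E; have [_] := derf p l0.
have := @differentiation_under_integral R _ _ (lebesgue_xt n) f setT measurableT
  1 (2^-1) 2 I1 _ _ G G0 intG _.
(* By [integral_f] the integral is constant for [l] near 1, so its derivative there is 0. *)
rewrite derive1E (@near_eq_derive _ _ _ _ (cst (\int[lebesgue_xt n]_p K p))).
  rewrite derive_cst => ->.
  - apply: eq_Rintegral => p _; rewrite -[RHS]/(partial1of2 f 1 p) D// expr1n mul1r.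
    by rewrite /T /grushin_dil scale1r expr1n mul1r; case: p.
  - by move=> l /integrable_f.
  - by move=> l p /half_gt0 l0 _; have [] := derf p l0.
  - move=> l p lI _; have l0 := half_gt0 lI; rewrite D// normrM.
    have [->|T0] := eqVneq (T (grushin_dil l p)) 0; first by rewrite normr0 mulr0.
    rewrite /G indicE mem_set ?mulr1; last exact: box_dil lI (TL T0).
    rewrite ler_pM// ger0_norm ?exprn_ge0 ?(ltW l0)//.
    rewrite (@le_trans _ _ (2 ^+ (homdim n).-1))//.
      rewrite lerXn2r ?nnegrE ?(ltW l0)//.
      by move: lI; rewrite /= in_itv/= => /andP[_ /ltW].
    by apply: ler_weXn2l; [lra|exact: leq_pred].
near=> l; apply: integral_f; near: l.
exact: near_in_itvoo.
Unshelve. all: by end_near. Qed.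

End dilation_invariance.

(** * Bessel pairs *)

Section real_derivatives.
Context {R : realType}.

Lemma derivable_is_derive1 (g : R -> R) r :
  derivable g r 1 -> is_derive r 1 g (derive1 g r).
Proof. by move=> dg; rewrite derive1E; exact: derivableP. Qed.

Lemma is_derive_div (E : normedModType R) (g f : E -> R) (p v : E) (dg df : R) :
  is_derive p v g dg -> is_derive p v f df -> f p != 0 ->
  is_derive p v (fun y => g y / f y) ((dg * f p - g p * df) / f p ^+ 2).
Proof.
move=> Dg [Df fE] f0.
have Dv : is_derive p v (fun y => (f y)^-1) (- (f p) ^- 2 *: df).
  by split; [exact: derivableV|rewrite deriveV// fE].
apply: (@is_derive_eq _ _ _ (g * (fun y => (f y)^-1))).
by rewrite /GRing.scale/=; field.
Qed.

End real_derivatives.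

Section bessel.
Context {R : realType} (n : nat) (rad : \bar R).
Context (V W f : R -> R) (VWf : bessel_pair (homdim n) rad V W f).
Local Notation rho := (@grushin_norm R n).
Local Notation Q := (homdim n).
Let Omega : set ('rV[R]_n * R) := gball rad `\ (0 : 'rV[R]_n * R).

Lemma Omega_neq0 p : Omega p -> p <> 0. Proof. by case. Qed.

Lemma Omega_radii p : Omega p -> radii rad (rho p).
Proof. by move=> [prad p0]; split => //; exact: grushin_norm_gt0. Qed.

(** The function G of the overview and its derivative. The formula for the derivative involves
    neither V' nor f'', so it is visibly continuous. *)
Let logflux r := r ^+ Q.-1 * V r * derive1 f r / f r.
Let dlogflux r := - r ^+ Q.-1 * (W r + V r * (derive1 f r / f r) ^+ 2).

(* This is the Bessel equation in Riccati form. *)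
Lemma is_derive_logflux r : radii rad r -> is_derive r 1 logflux (dlogflux r).
Proof.
case: VWf => _ _ [Cf odef] f0 rr.
have [dflux fluxE] := odef r rr; have [df _] := Cf r rr; have fr := f0 r rr.
have frn : f r != 0 by rewrite gt_eqF.
pose flux r := r ^+ Q.-1 * V r * derive1 f r.
have fluxE' : derive1 flux r = - (r ^+ Q.-1 * W r * f r).
  by apply/eqP; rewrite -addr_eq0; apply/eqP.
have D1 := derivable_is_derive1 dflux; rewrite -/flux fluxE' in D1.
have := is_derive_div D1 (derivable_is_derive1 df) frn.
rewrite (_ : _ / _ ^+ 2 = dlogflux r)//.
by rewrite /dlogflux /flux; field.
Qed.

(** * The test function and the dilation identity for its energy flux *)

Section compactly_supported.
Variables (u : 'rV[R]_n * R -> R) (uC : Cc_smooth Omega u).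
Let S := closure [set p | u p != 0].

Let SO : S `<=` Omega. Proof. by case: uC. Qed.
Let cS : compact S. Proof. by case: uC. Qed.
Let clS : closed S. Proof. exact: closed_closure. Qed.

Lemma u_notin_supp p : ~ S p -> u p = 0.
Proof.
by move=> Sp; apply: contrapT => /eqP up; apply: Sp; exact: subset_closure.
Qed.

Lemma near_notin_supp p : ~ S p -> \forall q \near p, ~ S q.
Proof. by move=> Sp; apply: open_nbhs_nbhs; split => //; exact: closed_openC. Qed.

(** Off the closed support [g] is locally zero. The condition on [g] covers both [u] and its
    quotient by [f (rho q)]. *)
Lemma derive_notin_supp (g : 'rV[R]_n * R -> R) v p :
  (forall q, u q = 0 -> g q = 0) -> ~ S p -> 'D_v g p = 0.
Proof.
move=> gu Sp; rewrite (@near_eq_derive _ _ _ _ (cst 0)) ?derive_cst//.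
by apply: filterS (near_notin_supp Sp) => q /u_notin_supp/gu.
Qed.

Lemma u_differentiable p : differentiable u p.
Proof. by case: uC => su _ _; have [] := su 1. Qed.

Lemma continuous_derive_u v : continuous ('D_v u).
Proof. by case: uC => su _ _; have [_] := su 1; exact. Qed.

Lemma continuous_u : continuous u.
Proof. by move=> p; exact/differentiable_continuous/u_differentiable. Qed.

Lemma euler_deriv_notin_supp p : ~ S p -> euler_deriv u p = 0.
Proof.
move=> Sp; rewrite /euler_deriv /partial_x /partial_t derive_notin_supp// mulr0 addr0.
by apply: big1 => i _; rewrite derive_notin_supp// mulr0.
Qed.

(** The weight, the function u^2 G(rho), and its image under E; the last term of [H] uses E rho =
    rho. *)
Let w p := grushin_psi p / rho p ^+ Q.
Let h p := u p ^+ 2 * logflux (rho p).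
Let H p := 2 * u p * euler_deriv u p * logflux (rho p)
           + u p ^+ 2 * rho p * dlogflux (rho p).

Let w_hom (c : R) p : 0 < c -> w (grushin_dil c p) = c ^- Q * w p.
Proof.
move=> c0; rewrite /w /grushin_psi grushin_norm_dil ?(ltW c0)// !enorm_sqr sqnormZ.
have c2 : c ^+ 2 != 0 by rewrite expf_neq0 ?gt_eqF.
rewrite !exprMn [X in X / (c ^+ Q * _)](_ : _ = sqnorm p.1 / rho p ^+ 2).
  by rewrite (invfM (c ^+ Q)) mulrCA.
by rewrite -mulf_div (divff c2) mul1r.
Qed.

(** If the dilated point lies in the support, its norm is an admissible radius and the chain rule
    applies. Otherwise the curve of dilations stays off the support for parameters near [c], and
    both sides vanish. *)
Let dh (c : R) p : 0 < c ->
  is_derive c 1 (fun l => h (grushin_dil l p)) (H (grushin_dil c p) / c).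
Proof.
move=> c0; have [Sp|Sp] := pselect (S (grushin_dil c p)).
  have Du := is_derive_dil c0 (u_differentiable (grushin_dil c p)).
  have /SO/Omega_radii := Sp; rewrite grushin_norm_dil ?(ltW c0)// => rr.
  have Dl : is_derive c 1 (logflux \o ( *%R (rho p)))
      (dlogflux (c * rho p) * rho p).
    have Dm : is_derive c 1 ( *%R (rho p)) (rho p).
      apply: (@is_derive_affine _ _ _ _ _ _ (rho p * c)) => k.
      by rewrite mulrDr [k%:A]mulr1 mulrC.
    by apply: is_derive1_comp; rewrite mulrC; exact: is_derive_logflux.
  apply: (@near_eq_is_derive _ _ _ ((fun l => u (grushin_dil l p)) ^+ 2 *
    (logflux \o ( *%R (rho p))))).
    near=> l; rewrite /h grushin_norm_dil ?(mulrC l)//.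
    by apply: ltW; near: l; exact: lt_nbhsr.
  apply: is_derive_eq.
  rewrite /H grushin_norm_dil ?(ltW c0)// /= /GRing.scale/= (mulrC (rho p)).
  rewrite -[((fun l : R => u (grushin_dil l p)) ^+ 2) c]/(
    u (grushin_dil c p) ^+ 2).
  by field; rewrite gt_eqF.
have -> : H (grushin_dil c p) / c = 0.
  by rewrite /H u_notin_supp// euler_deriv_notin_supp// expr0n/= mulr0 !mul0r addr0 mul0r.
apply: (@near_eq_is_derive _ _ _ (cst 0)).
have cg : {for c, continuous (fun l : R => grushin_dil l p : 'rV[R]_n * R)}.
  have H1 : (fun l : R => l *: p.1) @ c --> c *: p.1.
    by apply: cvgZ; [exact: cvg_id|exact: cvg_cst].
  have H2 : (fun l : R => l ^+ 2 * p.2) @ c --> c ^+ 2 * p.2.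
    by apply: cvgM; [apply: cvgM; exact: cvg_id|exact: cvg_cst].
  exact: (cvg_pair H1 H2).
have : \forall l \near c, ~ S (grushin_dil l p) by exact: (cg _ (near_notin_supp Sp)).
by apply: filterS => l /u_notin_supp hl; rewrite /h hl expr0n mul0r.
Unshelve. all: by end_near. Qed.

(** * Continuity of the weights and vanishing of the flux integral *)

Lemma continuous_on_rho (g : R -> R) :
  (forall r, radii rad r -> {for r, continuous g}) ->
  forall p, Omega p -> {for p, continuous (g \o rho)}.
Proof.
move=> cg p /Omega_radii rp; apply: continuous_comp; last exact: cg.
exact: continuous_grushin_norm.
Qed.

Lemma derivable_continuous (g : R -> R) r : derivable g r 1 -> {for r, continuous g}.
Proof. by move=> /derivable1_diffP/differentiable_continuous. Qed.

Lemma continuous_V r : radii rad r -> {for r, continuous V}.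
Proof. by case: VWf => CV _ _ _ /CV[/derivable_continuous]. Qed.

Lemma continuous_W r : radii rad r -> {for r, continuous W}.
Proof. by case: VWf => _ CW _ _ /CW[/derivable_continuous]. Qed.

Lemma continuous_logflux r : radii rad r -> {for r, continuous logflux}.
Proof. by move=> /is_derive_logflux[/derivable_continuous]. Qed.

Lemma continuous_dlogflux r : radii rad r -> {for r, continuous dlogflux}.
Proof.
case: (VWf) => _ _ [Cf _] f0 rr; have [df cf'] := Cf r rr; have fr := f0 r rr.
have ce : {for r, continuous (fun r : R => r ^+ Q.-1)} by exact: exprn_continuous.
have cr : {for r, continuous (fun r => derive1 f r / f r)}.
  apply: cvgM; first exact: cf'.
  by apply: cvgV; [rewrite gt_eqF|exact: derivable_continuous].
apply: cvgM; first by apply: cvgN; exact: ce.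
apply: cvgD; first exact: continuous_W.
by apply: cvgM; [exact: continuous_V|apply: cvgM; exact: cr].
Qed.

Lemma continuous_rhoX m : continuous (fun p => rho p ^+ m).
Proof.
move=> p; apply: (@continuous_comp _ _ _ rho (fun r => r ^+ m)).
  exact: continuous_grushin_norm.
exact: exprn_continuous.
Qed.

Lemma continuous_psi p : Omega p -> {for p, continuous (@grushin_psi R n)}.
Proof.
move=> Op; have r0 := grushin_norm_gt0 (Omega_neq0 Op).
apply: cvgM; last first.
  by apply: cvgV; [rewrite expf_neq0// gt_eqF|exact: continuous_rhoX].
suff : {for p, continuous (fun q : 'rV[R]_n * R => enorm q.1 ^+ 2)} by [].
under [X in {for p, continuous X}]eq_fun do rewrite enorm_sqr.
exact: continuous_sqnorm.
Qed.

Lemma continuous_w p : Omega p -> {for p, continuous w}.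
Proof.
move=> Op; have r0 := grushin_norm_gt0 (Omega_neq0 Op).
apply: cvgM; first exact: continuous_psi.
by apply: cvgV; [rewrite expf_neq0// gt_eqF|exact: continuous_rhoX].
Qed.

Lemma continuous_euler : continuous (euler_deriv u).
Proof.
move=> p; apply: cvgD.
  apply: continuous_sum => i q; apply: cvgM; first exact: continuous_coordx.
  exact: continuous_derive_u.
apply: cvgM; last exact: continuous_derive_u.
by apply: cvgM; [exact: cvg_cst|exact: cvg_snd].
Qed.

Lemma continuous_wh p : Omega p -> {for p, continuous (fun p => w p * h p)}.
Proof.
move=> Op; apply: cvgM; first exact: continuous_w.
apply: cvgM; first by apply: cvgM; exact: continuous_u.
exact: (continuous_on_rho continuous_logflux).
Qed.

Lemma continuous_wH p : Omega p -> {for p, continuous (fun p => w p * H p)}.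
Proof.
move=> Op; apply: cvgM; first exact: continuous_w.
apply: cvgD; apply: cvgM.
- apply: cvgM; last exact: continuous_euler.
  by apply: cvgM; [exact: cvg_cst|exact: continuous_u].
- exact: (continuous_on_rho continuous_logflux).
- apply: cvgM; last exact: continuous_grushin_norm.
  by apply: cvgM; exact: continuous_u.
- exact: (continuous_on_rho continuous_dlogflux).
Qed.

Lemma wh_notin_supp p : ~ S p -> w p * h p = 0.
Proof. by move=> Sp; rewrite /h u_notin_supp// expr0n mul0r mulr0. Qed.

Lemma wH_notin_supp p : ~ S p -> w p * H p = 0.
Proof.
by move=> Sp; rewrite /H u_notin_supp// expr0n/= mulr0 !mul0r addr0 mulr0.
Qed.

(** Both products extend continuously by zero, so they share a cube, and the larger of their bounds
    serves for both. *)
Lemma integral_wH0 : \int[lebesgue_xt n]_p (w p * H p) = 0.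
Proof.
have cK := continuous_ext0 SO clS continuous_wh wh_notin_supp.
have cT := continuous_ext0 SO clS continuous_wH wH_notin_supp.
have [M1 HM1] := continuous_cc_bounded cS cK wh_notin_supp.
have [M2 HM2] := continuous_cc_bounded cS cT wH_notin_supp.
have [L _ SL] := compact_box cS.
apply: (@integral_dilation_derivative0 _ _ w h H L (Num.max M1 M2)) => //.
- by move=> p; rewrite le_max HM1.
- by move=> p Kp; apply: SL; apply: contrapT => /wh_notin_supp /eqP; exact/negP.
- by move=> p; rewrite le_max HM2 orbT.
- by move=> p Kp; apply: SL; apply: contrapT => /wH_notin_supp /eqP; exact/negP.
Qed.

(** * Gradients of the norm and pointwise identities *)

Lemma partial_x_rho p i : p <> 0 ->
  partial_x i rho p = sqnorm p.1 * p.1 0 i / rho p ^+ 3.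
Proof.
move=> p0; rewrite /partial_x.
have [_ ->] := is_derive_grushin_norm (delta_mx 0 i, 0) p0.
rewrite mulr0 addr0 (bigD1 i)//= big1 ?addr0 => [|j ji].
  by rewrite mxE !eqxx mulr1.
by rewrite mxE eqxx/= (negbTE ji) mulr0.
Qed.

Lemma partial_t_rho p : p <> 0 -> partial_t rho p = 2 * p.2 / rho p ^+ 3.
Proof.
move=> p0; rewrite /partial_t.
have [_ ->] := is_derive_grushin_norm (0, 1) p0.
by rewrite big1 ?mulr0 ?add0r ?mulr1// => i _; rewrite mxE mulr0.
Qed.

(** With [a] the x-gradient of [u], the cross term is the x-part of [euler_deriv u]. *)
Lemma sum_sqr_lin (a x : 'I_n -> R) (s t : R) :
  \sum_i (s * a i - t * x i) ^+ 2 = s ^+ 2 * (\sum_i a i ^+ 2)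
  - 2 * s * t * (\sum_i x i * a i) + t ^+ 2 * (\sum_i x i ^+ 2).
Proof.
rewrite !mulr_sumr -sumrB -big_split/=; apply: eq_bigr => i _; ring.
Qed.

(** Oriented to eliminate |x|^4, so that the goals below become rational identities for [field]. *)
Lemma rho_sqr4 p : sqnorm p.1 ^+ 2 = rho p ^+ 4 - 4 * p.2 ^+ 2.
Proof. by rewrite grushin_norm4 /gauge4 addrK. Qed.

(** The squares add up to |x|^2 (|x|^4 + 4 t^2) / rho^6, and the bracket is rho^4. *)
Lemma sqnorm_grad_rho p : Omega p ->
  sqnorm_grad (grushin_grad rho p) = grushin_psi p.
Proof.
move=> Op; have p0 := Omega_neq0 Op.
have rn : rho p != 0 by rewrite gt_eqF// grushin_norm_gt0.
rewrite /sqnorm_grad /grushin_grad/= exprMn !enorm_sqr /grushin_psi enorm_sqr.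
rewrite partial_t_rho// {1}/sqnorm.
under eq_bigr do rewrite mxE partial_x_rho//.
have -> : \sum_i (sqnorm p.1 * p.1 0 i / rho p ^+ 3) ^+ 2 =
    (sqnorm p.1 / rho p ^+ 3) ^+ 2 * sqnorm p.1.
  by rewrite mulr_sumr; apply: eq_bigr => i _; rewrite mulrAC exprMn.
rewrite expr_div_n rho_sqr4; by field.
Qed.

Let v q := u q / f (rho q).

Lemma derive_v p e : Omega p -> 'D_e v p =
  'D_e u p / f (rho p) - u p * derive1 f (rho p) / f (rho p) ^+ 2 * 'D_e rho p.
Proof.
move=> Op; case: (VWf) => _ _ [Cf _] f0.
have rr := Omega_radii Op; have fr := f0 _ rr.
have [df _] := Cf _ rr.
have Du : is_derive p e u ('D_e u p).
  exact/derivableP/diff_derivable/u_differentiable.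
have [Dr rE] := is_derive_grushin_norm e (Omega_neq0 Op).
have Df : is_derive p e (f \o rho) (derive1 f (rho p) * 'D_e rho p).
  by apply: is_derive_comp1; [exact: derivableP|exact: derivable_is_derive1].
have fn : (f \o rho) p != 0 by rewrite /= gt_eqF.
have [_ ->] := is_derive_div Du Df fn.
by rewrite /=; field; rewrite gt_eqF.
Qed.

(** [A], [B], [C] are the integrands of the first identity in their order; the second one keeps [B]
    and has [A'], [C'] instead. *)
Let A p := V (rho p) * sqnorm_grad (grushin_grad u p).
Let B p := W (rho p) * u p ^+ 2 * sqnorm_grad (grushin_grad rho p).
Let C p := V (rho p) * sqnorm_grad (grushin_grad v p) * f (rho p) ^+ 2.
Let A' p := V (rho p) * sqnorm_polar (radial_grad u p).
Let C' p := V (rho p) * sqnorm_polar (radial_grad v p) * f (rho p) ^+ 2.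

(** Splits off one power of [r], so that the symbolic power in [w] cancels against the one in
    [logflux]. *)
Lemma exprQ (r : R) : r ^+ Q = r * r ^+ Q.-1.
Proof. by rewrite -exprS /homdim addn2. Qed.

(** The Grushin gradients of rho and [u] have inner product psi E u / rho, and that of rho has
    square psi. Expanding the gradient of u / f(rho) therefore leaves only terms in E u and u^2,
    which [w p * H p] collects. *)
Lemma pointwise_full p : S p -> A p = B p + C p + w p * H p.
Proof.
move=> /SO Op; have p0 := Omega_neq0 Op; have r0 := grushin_norm_gt0 p0.
have fr : 0 < f (rho p) by case: VWf => _ _ _; apply; exact: Omega_radii.
rewrite /A /B /C sqnorm_grad_rho// /sqnorm_grad /grushin_grad/= !exprMn !enorm_sqr.
rewrite /partial_t derive_v// -/(partial_t u p) -/(partial_t rho p) partial_t_rho//.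
rewrite [sqnorm (\row_i partial_x i v p)]/sqnorm.
under eq_bigr do rewrite mxE /partial_x derive_v// -/(partial_x _ u p)
  -/(partial_x _ rho p) partial_x_rho//.
have -> : \sum_i (partial_x i u p / f (rho p) - u p * derive1 f (rho p) /
    f (rho p) ^+ 2 * (sqnorm p.1 * p.1 0 i / rho p ^+ 3)) ^+ 2 =
  \sum_i ((f (rho p))^-1 * partial_x i u p - u p * derive1 f (rho p) /
    f (rho p) ^+ 2 * (sqnorm p.1 / rho p ^+ 3) * p.1 0 i) ^+ 2.
  by apply: eq_bigr => i _; congr (_ ^+ 2); ring.
rewrite sum_sqr_lin /w /H /grushin_psi enorm_sqr /euler_deriv exprQ.
rewrite /logflux /dlogflux -/(sqnorm p.1) {1}/sqnorm.
under eq_bigr do rewrite mxE.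
have rn : rho p != 0 by rewrite gt_eqF.
have fn : f (rho p) != 0 by rewrite gt_eqF.
(* In this term |x|^6 becomes |x|^2 (rho^4 - 4 t^2), whose second part cancels the square of the
   t-derivative of rho. *)
have -> : (u p * derive1 f (rho p) / f (rho p) ^+ 2 * (sqnorm p.1 / rho p ^+ 3))
      ^+ 2 * sqnorm p.1 =
    (u p * derive1 f (rho p) / f (rho p) ^+ 2) ^+ 2 *
      ((rho p ^+ 4 - 4 * p.2 ^+ 2) / rho p ^+ 6) * sqnorm p.1.
  by rewrite -rho_sqr4; field; rewrite rn fn.
by field; rewrite rn fn expf_neq0.
Qed.

(** Quotient rule together with E rho = rho, the Euler relation for a function homogeneous of degree
    1. *)
Lemma euler_deriv_v p : Omega p -> euler_deriv v p =
  euler_deriv u p / f (rho p) -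
  u p * derive1 f (rho p) / f (rho p) ^+ 2 * rho p.
Proof.
move=> Op; have p0 := Omega_neq0 Op.
have rn : rho p != 0 by rewrite gt_eqF// grushin_norm_gt0.
rewrite /euler_deriv /partial_t derive_v// -/(partial_t u p) -/(partial_t rho p).
rewrite partial_t_rho//.
under eq_bigr do rewrite /partial_x derive_v// -/(partial_x _ u p)
  -/(partial_x _ rho p) partial_x_rho//.
set k := u p * _ / _.
have -> : \sum_i p.1 0 i * (partial_x i u p / f (rho p) -
      k * (sqnorm p.1 * p.1 0 i / rho p ^+ 3)) =
    (\sum_i p.1 0 i * partial_x i u p) / f (rho p) -
    k / rho p ^+ 3 * (sqnorm p.1 ^+ 2).
  rewrite expr2 {3}/sqnorm !mulr_sumr mulr_suml -sumrB.
  by apply: eq_bigr => i _; ring.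
rewrite rho_sqr4.
have fn : f (rho p) != 0.
  by rewrite gt_eqF//; case: VWf => _ _ _; apply; exact: Omega_radii.
by field; rewrite rn fn.
Qed.

Lemma sqnorm_polar_radial (g : 'rV[R]_n * R -> R) p :
  sqnorm_polar (radial_grad g p) =
  grushin_psi p * (euler_deriv g p / rho p) ^+ 2.
Proof.
rewrite /sqnorm_polar /radial_grad/= (_ : sqnorm (0 : 'rV[R]_n) = 0).
  rewrite expr0n !addr0 exprMn sqr_sqrtr; last by rewrite divr_ge0 ?sqr_ge0.
  by rewrite /radial_deriv [_^-1 * _]mulrC.
by apply: big1 => i _; rewrite mxE expr0n.
Qed.

(** In the full expansion the cross term sees [u] only through E u, so the radial parts alone
    produce the same remainder. *)
Lemma pointwise_radial p : S p -> A' p = B p + C' p + w p * H p.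
Proof.
move=> /SO Op; have p0 := Omega_neq0 Op; have r0 := grushin_norm_gt0 p0.
have fr : 0 < f (rho p) by case: VWf => _ _ _; apply; exact: Omega_radii.
have rn : rho p != 0 by rewrite gt_eqF.
have fn : f (rho p) != 0 by rewrite gt_eqF.
rewrite /A' /B /C' sqnorm_grad_rho// !sqnorm_polar_radial euler_deriv_v//.
rewrite /w /H exprQ /logflux /dlogflux.
by field; rewrite rn fn expf_neq0.
Qed.

(** * Integration of the pointwise identities *)

Lemma integral_identity (F F' : 'rV[R]_n * R -> R) :
  (forall p, Omega p -> {for p, continuous F}) ->
  (forall p, ~ S p -> F p = 0) -> (forall p, ~ S p -> F' p = 0) ->
  (forall p, S p -> F p = B p + F' p + w p * H p) ->
  \int[lebesgue_xt n]_(p in gball rad) F p -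
  \int[lebesgue_xt n]_(p in gball rad) B p =
  \int[lebesgue_xt n]_(p in gball rad) F' p.
Proof.
move=> cF F0 F'0 FE.
have B0 p : ~ S p -> B p = 0.
  by move=> Sp; rewrite /B u_notin_supp// expr0n/= mulr0 mul0r.
(* All integrands vanish off the support, which lies in the ball; integrating over the whole space
   makes [integral_wH0] applicable. *)
have toT (G : 'rV[R]_n * R -> R) : (forall p, ~ S p -> G p = 0) ->
    \int[lebesgue_xt n]_(p in gball rad) G p = \int[lebesgue_xt n]_p G p.
  move=> G0; rewrite Rintegral_mkcond; congr (Rintegral _ _ _).
  apply/funext => p; rewrite patchE; case: ifPn => // /negP pB.
  by rewrite G0// => /SO[pB' _]; apply: pB; rewrite inE.
rewrite !toT//.
have iF := integrable_cc cS SO clS cF F0.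
have iB : (lebesgue_xt n).-integrable setT (EFin \o B).
  (* The gradient of rho is replaced by psi, whose continuity on [Omega] is known; off the support
     both sides vanish. *)
  rewrite (_ : B = fun p => W (rho p) * u p ^+ 2 * grushin_psi p).
    apply: (integrable_cc cS SO clS).
      move=> p Op; apply: cvgM; last exact: continuous_psi.
      apply: cvgM; first exact: (continuous_on_rho continuous_W).
      by apply: cvgM; exact: continuous_u.
    by move=> p Sp; rewrite u_notin_supp// expr0n/= mulr0 mul0r.
  apply/funext => p; have [/SO Op|Sp] := pselect (S p).
    by rewrite /B sqnorm_grad_rho.
  by rewrite B0// u_notin_supp// expr0n/= mulr0 mul0r.
have iT := integrable_cc cS SO clS continuous_wH wH_notin_supp.
have iFB : (lebesgue_xt n).-integrable setT (EFin \o (fun p => F p - B p)).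
  rewrite (_ : _ \o _ = (fun p => (F p)%:E - (B p)%:E)%E); last exact/funext.
  exact: integrableB.
(* This expresses [F'] through integrable functions, so the derivatives of u / f(rho) need no
   separate estimate. *)
have F'E p : F' p = F p - B p - w p * H p.
  have [/FE->|Sp] := pselect (S p); first ring.
  by rewrite F0// F'0// B0// wH_notin_supp// !subr0.
transitivity (\int[lebesgue_xt n]_p (F p - B p - w p * H p)).
  by rewrite !RintegralB// integral_wH0 subr0.
by apply: eq_Rintegral => p _; rewrite F'E.
Qed.

Lemma derive_v_notin_supp p : ~ S p -> forall e, 'D_e v p = 0.
Proof. by move=> Sp e; apply: derive_notin_supp => // q uq; rewrite /v uq mul0r. Qed.

Lemma sqnorm_grad_derive0 (g : 'rV[R]_n * R -> R) p : (forall e, 'D_e g p = 0) ->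
  sqnorm_grad (grushin_grad g p) = 0.
Proof.
move=> g0; rewrite /sqnorm_grad /= /partial_t g0 mulr0 expr0n addr0.
by apply: big1 => i _; rewrite mxE /partial_x g0 expr0n.
Qed.

Lemma sqnorm_polar_derive0 (g : 'rV[R]_n * R -> R) p : (forall e, 'D_e g p = 0) ->
  sqnorm_polar (radial_grad g p) = 0.
Proof.
move=> g0; rewrite sqnorm_polar_radial /euler_deriv /partial_t g0 mulr0 addr0.
rewrite big1 ?mul0r ?expr0n ?mulr0// => i _.
by rewrite /partial_x g0 mulr0.
Qed.

Lemma derive_u_notin_supp p : ~ S p -> forall e, 'D_e u p = 0.
Proof. by move=> Sp e; exact: derive_notin_supp. Qed.

Lemma hardy_identities :
  \int[lebesgue_xt n]_(p in gball rad) A p -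
  \int[lebesgue_xt n]_(p in gball rad) B p =
  \int[lebesgue_xt n]_(p in gball rad) C p /\
  \int[lebesgue_xt n]_(p in gball rad) A' p -
  \int[lebesgue_xt n]_(p in gball rad) B p =
  \int[lebesgue_xt n]_(p in gball rad) C' p.
Proof.
split; apply: integral_identity.
- move=> p Op; apply: cvgM; first exact: (continuous_on_rho continuous_V).
  suff : {for p, continuous (fun q => sqnorm_grad (grushin_grad u q))} by [].
  under [X in {for p, continuous X}]eq_fun do
    rewrite /sqnorm_grad /= exprMn enorm_sqr {1}/sqnorm.
  apply: cvgD.
    apply: continuous_sum => i q.
    have -> : (fun x : 'rV[R]_n * R => (\row_j partial_x j u x) 0 i ^+ 2) =
        (fun x => partial_x i u x ^+ 2) by apply/funext => x; rewrite mxE.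
    by apply: cvgM; exact: continuous_derive_u.
  apply: cvgM; first exact: continuous_sqnorm.
  by apply: cvgM; exact: continuous_derive_u.
- by move=> p /derive_u_notin_supp Sp; rewrite /A sqnorm_grad_derive0// mulr0.
- by move=> p /derive_v_notin_supp Sp; rewrite /C sqnorm_grad_derive0// mulr0 mul0r.
- exact: pointwise_full.
- move=> p Op; apply: cvgM; first exact: (continuous_on_rho continuous_V).
  suff : {for p, continuous (fun q => sqnorm_polar (radial_grad u q))} by [].
  under [X in {for p, continuous X}]eq_fun do rewrite sqnorm_polar_radial.
  have r0 := grushin_norm_gt0 (Omega_neq0 Op).
  apply: cvgM; first exact: continuous_psi.
  have cE : {for p, continuous (fun q => euler_deriv u q / rho q)}.
    apply: cvgM; first exact: continuous_euler.
    by apply: cvgV; [rewrite gt_eqF|exact: continuous_grushin_norm].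
  by apply: cvgM; exact: cE.
- by move=> p /derive_u_notin_supp Sp; rewrite /A' sqnorm_polar_derive0// mulr0.
- by move=> p /derive_v_notin_supp Sp; rewrite /C' sqnorm_polar_derive0// mulr0 mul0r.
- exact: pointwise_radial.
Qed.

End compactly_supported.

End bessel.

Theorem theorem1p1 (R : realType) (n : nat) (n_ge2 : (2 <= n)%N)
    (rad : \bar R) (rad_gt0 : (0 < rad)%E) (V W f : R -> R)
    (VWf : bessel_pair (homdim n) rad V W f) (u : 'rV[R]_n * R -> R)
    (uC : Cc_smooth (gball rad `\ (0 : 'rV[R]_n * R)) u) :
  \int[lebesgue_xt n]_(p in gball rad)
      (V (grushin_norm p) * sqnorm_grad (grushin_grad u p))
  - \int[lebesgue_xt n]_(p in gball rad)
      (W (grushin_norm p) * u p ^+ 2 *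
       sqnorm_grad (grushin_grad (@grushin_norm R n) p))
  = \int[lebesgue_xt n]_(p in gball rad)
      (V (grushin_norm p) *
       sqnorm_grad (grushin_grad (fun q => u q / f (grushin_norm q)) p) *
       f (grushin_norm p) ^+ 2)
  /\
  \int[lebesgue_xt n]_(p in gball rad)
      (V (grushin_norm p) * sqnorm_polar (radial_grad u p))
  - \int[lebesgue_xt n]_(p in gball rad)
      (W (grushin_norm p) * u p ^+ 2 *
       sqnorm_grad (grushin_grad (@grushin_norm R n) p))
  = \int[lebesgue_xt n]_(p in gball rad)
      (V (grushin_norm p) *
       sqnorm_polar (radial_grad (fun q => u q / f (grushin_norm q)) p) *
       f (grushin_norm p) ^+ 2).
Proof. exact: (hardy_identities VWf uC). Qed.
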